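(* Let $\mathcal C$ be a homological category and let $\mathcal X$ be a full reflective subcategory of $\mathcal C$, with inclusion $U\colon\mathcal X\to\mathcal C$, reflector (left adjoint) $F\colon\mathcal C\to\mathcal X$, unit $\eta\colon 1_{\mathcal C}\Rightarrow UF$ and corresponding localization functor $L=UF$. Assume that $L$ admits a functorial fiberwise localization. Then $L$ is conditionally flat if and only if it (i.e. the reflector $F$) is admissible with respect to regular epimorphisms.
   Context: A category is regular if it is finitely complete, every morphism factors as a regular epimorphism followed by a monomorphism, and regular epimorphisms are stable under pullback. A homological category is a pointed regular category (zero object $0$) in which the Split Short Five Lemma holds: for any morphism $(u,v,w)$ between split epimorphisms (with chosen kernels, and compatible with the splittings), $u\colon K\to K'$ on kernels, $v\colon A\to A'$, $w\colon B\to B'$, if $u$ and $w$ are isomorphisms then so is $v$. An extension in $\mathcal C$ is a short exact sequence $0\to K\to E\to Q\to 0$ (the first map is a kernel of the second, the second is a cokernel of the first). A morphism is inverted by $L$ if $L$ sends it to an isomorphism. An extension is $L$-flat if $0\to L(K)\to L(E)\to L(Q)\to 0$ is again an extension. The functor $L$ is conditionally flat if every pullback of an $L$-flat extension is $L$-flat: for every $L$-flat extension $0\to K\to E\to Q\to 0$ and every morphism $X\to Q$, the induced extension $0\to K\to E\times_Q X\to X\to 0$ is $L$-flat. An extension $0\to K\to E\to Q\to 0$ admits a fiberwise localization (with respect to $L$) if there is an extension $0\to L(K)\to\overline E\to Q\to 0$ and a morphism $e\colon E\to\overline E$ inverted by $L$ such that $(\eta_K,e,1_Q)$ is a morphism of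 extensions. The functor $L$ admits a functorial fiberwise localization if every extension is assigned a fiberwise localization in a functorial way: every morphism of extensions $(u,v,w)$ from $0\to K\to E\to Q\to 0$ to $0\to K'\to E'\to Q'\to 0$ is assigned a morphism $\overline v\colon\overline E\to\overline{E'}$ such that $(L(u),\overline v,w)$ is a morphism between the fiberwise localized extensions and $\overline v\circ e=e'\circ v$, and this assignment preserves identities and composition. The reflector $F$ is admissible with respect to regular epimorphisms if, for every object $X$ of $\mathcal C$ and every morphism $x\colon E\to F(X)$ in $\mathcal X$ such that $U(x)$ is a regular epimorphism in $\mathcal C$, the functor $F$ preserves the pullback $P=X\times_{UF(X)}U(E)$ of $\eta_X\colon X\to UF(X)$ and $U(x)\colon U(E)\to UF(X)$. *)

(* Defs.v *)
From Stdlib Require Import List.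

Set Implicit Arguments.
Unset Strict Implicit.
Unset Printing Implicit Defensive.

Declare Scope cat_scope.
Delimit Scope cat_scope with cat.
Local Open Scope cat_scope.

Record category := Category {
  ob :> Type;
  hom : ob -> ob -> Type;
  idm : forall a, hom a a;
  comp : forall a b c, hom b c -> hom a b -> hom a c;
  comp_idl : forall a b (f : hom a b), comp (idm b) f = f;
  comp_idr : forall a b (f : hom a b), comp f (idm a) = f;
  comp_assoc : forall a b c d (h : hom c d) (g : hom b c) (f : hom a b),
    comp h (comp g f) = comp (comp h g) f
}.

Arguments hom {c} a b : rename.
Arguments idm {c} a : rename.
Arguments comp {c a b c0} g f : rename.

Notation "g ∘ f" := (comp g f) (at level 40, left associativity) : cat_scope.

Record functor (C D : category) := Functor {
  fob :> ob C -> ob D;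
  fmap : forall a b : C, hom a b -> hom (fob a) (fob b);
  fmap_id : forall a : C, fmap (idm a) = idm (fob a);
  fmap_comp : forall (a b c : C) (g : hom b c) (f : hom a b),
    fmap (g ∘ f) = fmap g ∘ fmap f
}.

Arguments fmap {C D} F {a b} f : rename.

Definition functor_id (C : category) : functor C C :=
  @Functor C C (fun a => a) (fun _ _ f => f)
    (fun _ => eq_refl) (fun _ _ _ _ _ => eq_refl).

Program Definition functor_comp (C D E : category)
    (G : functor D E) (F : functor C D) : functor C E :=
  @Functor C E (fun a => G (F a)) (fun _ _ f => fmap G (fmap F f)) _ _.
Next Obligation. now rewrite !fmap_id. Qed.
Next Obligation. now rewrite !fmap_comp. Qed.

Record nat_trans (C D : category) (F G : functor C D) := NatTrans {
  ntapp :> forall a : C, hom (F a) (G a);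
  nt_natural : forall (a b : C) (f : hom a b),
    ntapp b ∘ fmap F f = fmap G f ∘ ntapp a
}.

Program Definition full_subcategory (C : category) (P : C -> Prop) : category :=
  @Category {a : C | P a} (fun a b => hom (proj1_sig a) (proj1_sig b))
    (fun a => idm (proj1_sig a)) (fun _ _ _ g f => g ∘ f) _ _ _.
Next Obligation. apply comp_idl. Qed.
Next Obligation. apply comp_idr. Qed.
Next Obligation. apply comp_assoc. Qed.

Definition inclusion (C : category) (P : C -> Prop) :
    functor (full_subcategory P) C :=
  @Functor (full_subcategory P) C (fun a => proj1_sig a) (fun _ _ f => f)
    (fun _ => eq_refl) (fun _ _ _ _ _ => eq_refl).

(* [F] is left adjoint to [U] with unit [eta]: each [eta a] is a universal
   arrow from [a] to [U]. *)
Definition left_adjoint_with_unit (C X : category) (F : functor C X)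
    (U : functor X C) (eta : nat_trans (functor_id C) (functor_comp U F)) : Prop :=
  forall (a : C) (y : X) (f : hom a (U y)),
    exists! g : hom (F a) y, fmap U g ∘ eta a = f.

Definition finite_category (J : category) : Prop :=
  (exists s : list J, forall j : J, In j s) /\
  (forall i j : J, exists s : list (hom i j), forall f : hom i j, In f s).

Definition is_cone (J C : category) (D : functor J C) (l : C)
    (p : forall j : J, hom l (D j)) : Prop :=
  forall (i j : J) (f : hom i j), fmap D f ∘ p i = p j.

Definition is_limit (J C : category) (D : functor J C) (l : C)
    (p : forall j : J, hom l (D j)) : Prop :=
  is_cone p /\
  forall (t : C) (r : forall j : J, hom t (D j)), is_cone r ->
    exists! h : hom t l, forall j : J, p j ∘ h = r j.

Definition finitely_complete (C : category) : Prop :=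
  forall (J : category) (D : functor J C), finite_category J ->
    exists (l : C) (p : forall j : J, hom l (D j)), is_limit p.

Section InCategory.
Variable C : category.
Implicit Types a b c d t z : C.

Definition is_iso a b (f : hom a b) : Prop :=
  exists g : hom b a, g ∘ f = idm a /\ f ∘ g = idm b.

Definition is_mono a b (f : hom a b) : Prop :=
  forall t (g h : hom t a), f ∘ g = f ∘ h -> g = h.

Definition is_coequalizer a b c (f g : hom a b) (q : hom b c) : Prop :=
  q ∘ f = q ∘ g /\
  forall t (h : hom b t), h ∘ f = h ∘ g -> exists! r : hom c t, r ∘ q = h.

Definition is_regular_epi b c (q : hom b c) : Prop :=
  exists a (f g : hom a b), is_coequalizer f g q.

(*       p1
      d ----> a
   p2 |       | f
      v       v
      b ----> c
          g        *)
Definition is_pullback a b c d (f : hom a c) (g : hom b c)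
    (p1 : hom d a) (p2 : hom d b) : Prop :=
  f ∘ p1 = g ∘ p2 /\
  forall t (r1 : hom t a) (r2 : hom t b), f ∘ r1 = g ∘ r2 ->
    exists! h : hom t d, p1 ∘ h = r1 /\ p2 ∘ h = r2.

Definition is_regular : Prop :=
  finitely_complete C /\
  (forall a b (f : hom a b), exists c (q : hom a c) (m : hom c b),
     is_regular_epi q /\ is_mono m /\ f = m ∘ q) /\
  (forall a b c d (f : hom a c) (g : hom b c) (p1 : hom d a) (p2 : hom d b),
     is_pullback f g p1 p2 -> is_regular_epi f -> is_regular_epi p2).

Definition is_zero_object z : Prop :=
  (forall a, exists f : hom z a, forall g : hom z a, g = f) /\
  (forall a, exists f : hom a z, forall g : hom a z, g = f).

Definition is_pointed : Prop := exists z, is_zero_object z.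

Definition is_zero_morphism a b (f : hom a b) : Prop :=
  exists z (i : hom a z) (j : hom z b), is_zero_object z /\ f = j ∘ i.

Definition is_kernel k a b (i : hom k a) (f : hom a b) : Prop :=
  is_zero_morphism (f ∘ i) /\
  forall t (h : hom t a), is_zero_morphism (f ∘ h) ->
    exists! r : hom t k, i ∘ r = h.

Definition is_cokernel a b c (q : hom b c) (f : hom a b) : Prop :=
  is_zero_morphism (q ∘ f) /\
  forall t (h : hom b t), is_zero_morphism (h ∘ f) ->
    exists! r : hom c t, r ∘ q = h.

Definition split_short_five_lemma : Prop :=
  forall (K A B K' A' B' : C)
    (k : hom K A) (p : hom A B) (s : hom B A)
    (k' : hom K' A') (p' : hom A' B') (s' : hom B' A')
    (u : hom K K') (v : hom A A') (w : hom B B'),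
    p ∘ s = idm B -> is_kernel k p ->
    p' ∘ s' = idm B' -> is_kernel k' p' ->
    v ∘ k = k' ∘ u -> p' ∘ v = w ∘ p -> v ∘ s = s' ∘ w ->
    is_iso u -> is_iso w -> is_iso v.

Definition is_homological : Prop :=
  is_pointed /\ is_regular /\ split_short_five_lemma.

Definition is_extension K E Q (k : hom K E) (q : hom E Q) : Prop :=
  is_kernel k q /\ is_cokernel q k.

Record extension := Extension {
  ext_K : C;
  ext_E : C;
  ext_Q : C;
  ext_k : hom ext_K ext_E;
  ext_q : hom ext_E ext_Q;
  ext_exact : is_extension ext_k ext_q
}.

Record ext_morphism (x y : extension) := ExtMorphism {
  em_u : hom (ext_K x) (ext_K y);
  em_v : hom (ext_E x) (ext_E y);
  em_w : hom (ext_Q x) (ext_Q y);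
  em_k : em_v ∘ ext_k x = ext_k y ∘ em_u;
  em_q : ext_q y ∘ em_v = em_w ∘ ext_q x
}.

Program Definition ext_id (x : extension) : ext_morphism x x :=
  @ExtMorphism x x (idm _) (idm _) (idm _) _ _.
Next Obligation. now rewrite comp_idl, comp_idr. Qed.
Next Obligation. now rewrite comp_idl, comp_idr. Qed.

Program Definition ext_comp (x y z : extension)
    (n : ext_morphism y z) (m : ext_morphism x y) : ext_morphism x z :=
  @ExtMorphism x z (em_u n ∘ em_u m) (em_v n ∘ em_v m) (em_w n ∘ em_w m) _ _.
Next Obligation.
now rewrite <- comp_assoc, em_k, comp_assoc, em_k, <- comp_assoc.
Qed.
Next Obligation.
now rewrite comp_assoc, em_q, <- comp_assoc, em_q, comp_assoc.
Qed.

End InCategory.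

Section Localization.
Variables (C : category) (L : functor C C) (eta : nat_trans (functor_id C) L).

Definition inverted (a b : C) (f : hom a b) : Prop := is_iso (fmap L f).

Definition is_flat (K E Q : C) (k : hom K E) (q : hom E Q) : Prop :=
  is_extension k q /\ is_extension (fmap L k) (fmap L q).

(* The induced extension 0 -> K -> E x_Q X -> X -> 0 has as first map the
   morphism [k'] with components [k] and [0]. *)
Definition conditionally_flat : Prop :=
  forall (K E Q X P : C) (k : hom K E) (q : hom E Q) (x : hom X Q)
    (p1 : hom P E) (p2 : hom P X) (k' : hom K P),
    is_flat k q ->
    is_pullback q x p1 p2 ->
    p1 ∘ k' = k -> is_zero_morphism (p2 ∘ k') ->
    is_flat k' p2.

Record fiberwise_localization (x : extension C) := FiberwiseLocalization {
  fl_E : C;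
  fl_k : hom (L (ext_K x)) fl_E;
  fl_q : hom fl_E (ext_Q x);
  fl_exact : is_extension fl_k fl_q;
  fl_e : hom (ext_E x) fl_E;
  fl_inverted : inverted fl_e;
  fl_comm_k : fl_e ∘ ext_k x = fl_k ∘ eta (ext_K x);
  fl_comm_q : fl_q ∘ fl_e = idm (ext_Q x) ∘ ext_q x
}.

Record functorial_fiberwise_localization := FunctorialFiberwiseLocalization {
  ffl_loc :> forall x : extension C, fiberwise_localization x;
  ffl_map : forall x y : extension C, ext_morphism x y ->
    hom (fl_E (ffl_loc x)) (fl_E (ffl_loc y));
  ffl_comm_k : forall (x y : extension C) (m : ext_morphism x y),
    ffl_map m ∘ fl_k (ffl_loc x) = fl_k (ffl_loc y) ∘ fmap L (em_u m);
  ffl_comm_q : forall (x y : extension C) (m : ext_morphism x y),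
    fl_q (ffl_loc y) ∘ ffl_map m = em_w m ∘ fl_q (ffl_loc x);
  ffl_comm_e : forall (x y : extension C) (m : ext_morphism x y),
    ffl_map m ∘ fl_e (ffl_loc x) = fl_e (ffl_loc y) ∘ em_v m;
  ffl_map_id : forall x : extension C, ffl_map (ext_id x) = idm _;
  ffl_map_comp : forall (x y z : extension C)
    (n : ext_morphism y z) (m : ext_morphism x y),
    ffl_map (ext_comp n m) = ffl_map n ∘ ffl_map m
}.

Definition admits_functorial_fiberwise_localization : Prop :=
  inhabited functorial_fiberwise_localization.

End Localization.

(* The preserved square is a pullback in [X], the codomain of [F]. *)
Definition admissible_regular_epi (C X : category) (F : functor C X)
    (U : functor X C) (eta : nat_trans (functor_id C) (functor_comp U F)) : Prop :=
  forall (A : C) (E : X) (x : hom E (F A)), is_regular_epi (fmap U x) ->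
  forall (P : C) (p1 : hom P A) (p2 : hom P (U E)),
    is_pullback (eta A : hom A (U (F A))) (fmap U x) p1 p2 ->
    is_pullback (fmap F (eta A : hom A (U (F A)))) (fmap F (fmap U x))
      (fmap F p1) (fmap F p2).

(* Main.v *)
(* If L is conditionally flat and x : E -> L A is a regular epimorphism between
   local objects, then the extension of x is L-flat, all its terms being local.
   So is its pullback along the unit A -> L A, and the Short Five Lemma shows
   that the projection P -> E is inverted by L, which is admissibility.

   Conversely, let P -> X be the pullback of an L-flat extension E -> Q along
   X -> Q, and let P', E' be the middle objects of the fiberwise localizations.
   As extension morphisms that are invertible on kernels are pullback squares,
   P' is the pullback of E' along X -> Q, and E' is the pullback of
   L E -> L Q along the unit Q -> L Q. Hence P' is the pullback of the local
   object W = L X x_(L Q) L E along the unit X -> L X, and admissibility yields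
   L P = L P' = W, which is an extension of L X by L K. *)
Require Import Defs.
From Corelib Require Import ssreflect.
From Stdlib Require Import List.

Set Implicit Arguments.
Unset Strict Implicit.
Unset Printing Implicit Defensive.

Local Open Scope cat_scope.

(** * Isomorphisms, regular epimorphisms and the calculus of pullback squares *)

Section Morphisms.
Variable C : category.
Implicit Types a b c d t : C.

Lemma is_iso_id a : is_iso (idm a).
Proof. by exists (idm a); rewrite comp_idl. Qed.

Lemma is_iso_comp a b c (g : hom b c) (f : hom a b) :
  is_iso g -> is_iso f -> is_iso (g ∘ f).
Proof.
move=> [g' [g'g gg']] [f' [f'f ff']]; exists (f' ∘ g'); split.
- by rewrite -comp_assoc (comp_assoc g') g'g comp_idl.
- by rewrite -comp_assoc (comp_assoc f) ff' comp_idl.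
Qed.

Lemma is_regular_epi_epi b c (q : hom b c) t (g h : hom c t) :
  is_regular_epi q -> g ∘ q = h ∘ q -> g = h.
Proof.
move=> [a [f1 [f2 [qf univ]]]] gh.
have [|r [_ r_uniq]] := univ t (g ∘ q); first by rewrite -!comp_assoc qf.
by rewrite -(r_uniq g) // -(r_uniq h).
Qed.

(** As [m] is monic, [h] equalizes the pair of which [r] is the coequalizer. Hence [h] factors
    through [r], which provides a section of [m], and a monomorphism with a section is
    invertible. *)
Lemma is_regular_epi_mono_iso a b c (r : hom a c) (h : hom a b) (m : hom b c) :
  is_regular_epi r -> is_mono m -> m ∘ h = r -> is_iso m.
Proof.
move=> r_epi m_mono mh; have [d [f1 [f2 [rf univ]]]] := r_epi.
have [|s [sr _]] := univ b h.
  by apply: m_mono; rewrite !comp_assoc mh.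
have ms : m ∘ s = idm c.
  by apply: (is_regular_epi_epi r_epi); rewrite -comp_assoc sr comp_idl.
exists s; split=> //.
by apply: m_mono; rewrite comp_assoc ms comp_idl comp_idr.
Qed.

Lemma is_pullback_lift a b c d (f : hom a c) (g : hom b c)
    (p1 : hom d a) (p2 : hom d b) t (r1 : hom t a) (r2 : hom t b) :
  is_pullback f g p1 p2 -> f ∘ r1 = g ∘ r2 ->
  exists h : hom t d, p1 ∘ h = r1 /\ p2 ∘ h = r2.
Proof. by move=> [_ univ] /univ [h [hP _]]; exists h. Qed.

Lemma is_pullback_jointly_monic a b c d (f : hom a c) (g : hom b c)
    (p1 : hom d a) (p2 : hom d b) t (h h' : hom t d) :
  is_pullback f g p1 p2 -> p1 ∘ h = p1 ∘ h' -> p2 ∘ h = p2 ∘ h' -> h = h'.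
Proof.
move=> [fg univ] h1 h2.
have [|r [_ r_uniq]] := univ t (p1 ∘ h') (p2 ∘ h').
  by rewrite !comp_assoc fg.
by rewrite -(r_uniq h) // -(r_uniq h').
Qed.

Lemma is_pullback_intro a b c d (f : hom a c) (g : hom b c)
    (p1 : hom d a) (p2 : hom d b) :
  f ∘ p1 = g ∘ p2 ->
  (forall t (r1 : hom t a) (r2 : hom t b), f ∘ r1 = g ∘ r2 ->
    exists h : hom t d, p1 ∘ h = r1 /\ p2 ∘ h = r2) ->
  (forall t (h h' : hom t d),
    p1 ∘ h = p1 ∘ h' -> p2 ∘ h = p2 ∘ h' -> h = h') ->
  is_pullback f g p1 p2.
Proof.
move=> fg ex uniq; split=> // t r1 r2 /ex [h [h1 h2]].
exists h; split=> // h' [h'1 h'2].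
by apply: uniq; rewrite ?h1 ?h2 ?h'1 ?h'2.
Qed.

Lemma is_pullback_sym a b c d (f : hom a c) (g : hom b c)
    (p1 : hom d a) (p2 : hom d b) :
  is_pullback f g p1 p2 -> is_pullback g f p2 p1.
Proof.
move=> pb; apply: is_pullback_intro.
- by rewrite (proj1 pb).
- by move=> t r1 r2 e; have [h [h1 h2]] := is_pullback_lift pb (eq_sym e); exists h.
- by move=> t h h' h2 h1; apply: (is_pullback_jointly_monic pb).
Qed.

Lemma is_pullback_comp_iso a b c d d' (f : hom a c) (g : hom b c)
    (p1 : hom d a) (p2 : hom d b) (i : hom d' d) :
  is_pullback f g p1 p2 -> is_iso i -> is_pullback f g (p1 ∘ i) (p2 ∘ i).
Proof.
move=> pb [j [ji ij]]; apply: is_pullback_intro.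
- by rewrite !comp_assoc (proj1 pb).
- move=> t r1 r2 e; have [h [h1 h2]] := is_pullback_lift pb e.
  by exists (j ∘ h); rewrite -!comp_assoc !(comp_assoc i) ij !comp_idl.
- move=> t h h'; rewrite -!comp_assoc => h1 h2.
  have ih : i ∘ h = i ∘ h' by apply: (is_pullback_jointly_monic pb).
  by rewrite -(comp_idl h) -(comp_idl h') -ji -!comp_assoc ih.
Qed.

Lemma is_pullback_of_isos a b c d (f : hom a c) (g : hom b c)
    (p1 : hom d a) (p2 : hom d b) :
  f ∘ p1 = g ∘ p2 -> is_iso f -> is_iso p2 -> is_pullback f g p1 p2.
Proof.
move=> fg [f' [f'f ff']] [j [jp pj]]; apply: is_pullback_intro => //.
- move=> t r1 r2 e; exists (j ∘ r2); split; last first.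
    by rewrite comp_assoc pj comp_idl.
  rewrite -(comp_idl (p1 ∘ _)) -f'f -comp_assoc (comp_assoc f) fg.
  by rewrite -(comp_assoc g) (comp_assoc p2) pj comp_idl -e comp_assoc f'f comp_idl.
- by move=> t h h' _ e; rewrite -(comp_idl h) -(comp_idl h') -jp -!comp_assoc e.
Qed.

Lemma is_pullback_iso a b c d (f : hom a c) (g : hom b c)
    (p1 : hom d a) (p2 : hom d b) :
  is_pullback f g p1 p2 -> is_iso f -> is_iso p2.
Proof.
move=> pb [f' [f'f ff']].
have [|j [j1 j2]] := is_pullback_lift (r1 := f' ∘ g) (r2 := idm b) pb.
  by rewrite comp_assoc ff' comp_idl comp_idr.
exists j; split=> //.
apply: (is_pullback_jointly_monic pb); rewrite comp_assoc comp_idr.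
  by rewrite j1 -comp_assoc -(proj1 pb) comp_assoc f'f comp_idl.
by rewrite j2 comp_idl.
Qed.

(*    e --q1--> d --p1--> a
   q2 |      p2 |         | f
      v         v         v
      x ---h--> b ---g--> c      *)
Lemma is_pullback_paste a b c d e x (f : hom a c) (g : hom b c)
    (p1 : hom d a) (p2 : hom d b) (h : hom x b) (q1 : hom e d) (q2 : hom e x) :
  is_pullback f g p1 p2 -> is_pullback p2 h q1 q2 ->
  is_pullback f (g ∘ h) (p1 ∘ q1) q2.
Proof.
move=> pb pb'; apply: is_pullback_intro.
- by rewrite comp_assoc (proj1 pb) -!comp_assoc (proj1 pb').
- move=> t r1 r2; rewrite -comp_assoc => r; have [s [s1 s2]] := is_pullback_lift pb r.
  have [u [u1 u2]] := is_pullback_lift pb' s2.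
  by exists u; rewrite -comp_assoc u1.
- move=> t s s'; rewrite -!comp_assoc => s1 s2.
  apply: (is_pullback_jointly_monic pb') => //.
  apply: (is_pullback_jointly_monic pb) => //.
  by rewrite !comp_assoc (proj1 pb') -!comp_assoc s2.
Qed.

Lemma is_pullback_cancel a b c d e x (f : hom a c) (g : hom b c)
    (p1 : hom d a) (p2 : hom d b) (h : hom x b) (q1 : hom e d) (q2 : hom e x) :
  is_pullback f g p1 p2 -> is_pullback f (g ∘ h) (p1 ∘ q1) q2 ->
  p2 ∘ q1 = h ∘ q2 -> is_pullback p2 h q1 q2.
Proof.
move=> pb pb' comm; apply: is_pullback_intro => //.
- move=> t r1 r2 r.
  have [|s [s1 s2]] := is_pullback_lift (r1 := p1 ∘ r1) (r2 := r2) pb'.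
    by rewrite comp_assoc (proj1 pb) -!comp_assoc r.
  exists s; split=> //; apply: (is_pullback_jointly_monic pb).
    by rewrite comp_assoc.
  by rewrite comp_assoc comm -comp_assoc s2.
- move=> t s s' s1 s2; apply: (is_pullback_jointly_monic pb') => //.
  by rewrite -!comp_assoc s1.
Qed.

Lemma fmap_iso (D : category) (G : functor C D) a b (f : hom a b) :
  is_iso f -> is_iso (fmap G f).
Proof.
by move=> [g [gf fg]]; exists (fmap G g); rewrite -!fmap_comp gf fg !fmap_id.
Qed.

End Morphisms.

(** * Pullbacks as limits over the cospan *)

Section Pullbacks.
Variable C : category.

Inductive cospan_ob := cospan_left | cospan_right | cospan_vertex.

(** Each hom-set has at most one element, so every category law follows from irrelevance. *)
Definition cospan_hom (i j : cospan_ob) : Set :=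
  match i, j with
  | cospan_left, cospan_left | cospan_right, cospan_right
  | _, cospan_vertex => unit
  | _, _ => Empty_set
  end.

Lemma cospan_hom_irrelevance i j (f g : cospan_hom i j) : f = g.
Proof. by move: i j f g; do 2 case; do 2 case. Qed.

Definition cospan_id (i : cospan_ob) : cospan_hom i i :=
  match i with cospan_left | cospan_right | cospan_vertex => tt end.

Definition cospan_comp (i j k : cospan_ob) :
  cospan_hom j k -> cospan_hom i j -> cospan_hom i k.
Proof. by case: i; case: j; case: k. Defined.

Definition cospan_category : category :=
  @Category cospan_ob cospan_hom cospan_id cospan_comp
    (fun _ _ _ => cospan_hom_irrelevance _ _)
    (fun _ _ _ => cospan_hom_irrelevance _ _)
    (fun _ _ _ _ _ _ _ => cospan_hom_irrelevance _ _).

Lemma finite_cospan_category : finite_category cospan_category.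
Proof.
split.
  exists (cospan_left :: cospan_right :: cospan_vertex :: nil).
  by case; simpl; tauto.
case; case; (by exists nil; case) || (exists (tt :: nil); case; by left).
Qed.

Variables (a b c : C) (f : hom a c) (g : hom b c).

Definition cospan_fob (i : cospan_ob) : C :=
  match i with
  | cospan_left => a | cospan_right => b | cospan_vertex => c
  end.

Definition cospan_fmap (i j : cospan_ob) :
  cospan_hom i j -> hom (cospan_fob i) (cospan_fob j) :=
  match i, j with
  | cospan_left, cospan_left => fun _ => idm a
  | cospan_left, cospan_vertex => fun _ => f
  | cospan_right, cospan_right => fun _ => idm b
  | cospan_right, cospan_vertex => fun _ => g
  | cospan_vertex, cospan_vertex => fun _ => idm c
  | _, _ => fun e => match e with end
  end.

Lemma cospan_fmap_id i : cospan_fmap (cospan_id i) = idm (cospan_fob i).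
Proof. by case: i. Qed.

Lemma cospan_fmap_comp i j k (v : cospan_hom j k) (u : cospan_hom i j) :
  cospan_fmap (cospan_comp v u) = cospan_fmap v ∘ cospan_fmap u.
Proof.
by case: i j k u v => [] [] [] [] [] /=; rewrite ?comp_idl ?comp_idr.
Qed.

Definition cospan_functor : functor cospan_category C :=
  @Functor cospan_category C cospan_fob cospan_fmap
    cospan_fmap_id cospan_fmap_comp.

Lemma pullback_exists : finitely_complete C ->
  exists d (p1 : hom d a) (p2 : hom d b), is_pullback f g p1 p2.
Proof.
move=> /(_ _ cospan_functor finite_cospan_category) [d [p [cone univ]]].
exists d, (p cospan_left), (p cospan_right).
have pl : f ∘ p cospan_left = p cospan_vertex :=
  cone cospan_left cospan_vertex tt.
have pr : g ∘ p cospan_right = p cospan_vertex :=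
  cone cospan_right cospan_vertex tt.
split; first by rewrite pl pr.
move=> t r1 r2 r.
pose s := fun j : cospan_ob => match j return hom t (cospan_fob j) with
  | cospan_left => r1 | cospan_right => r2 | cospan_vertex => f ∘ r1 end.
have [|h [hP h_uniq]] := univ t s.
  by case; case; case; rewrite /= ?comp_idl.
exists h; split; first by split; [exact: (hP cospan_left)|exact: (hP cospan_right)].
move=> h' [h'1 h'2]; apply: h_uniq; case=> //=.
by rewrite -pl -comp_assoc h'1.
Qed.

End Pullbacks.

(** * Zero morphisms, kernels and equalizers in a pointed category *)

Section ZeroMorphisms.
Variable C : category.
Hypothesis pointed : is_pointed C.
Implicit Types a b c d t : C.

Lemma zero_morphism_exists a b : exists f : hom a b, is_zero_morphism f.
Proof.
have [z hz] := pointed.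
have [i _] := proj2 hz a; have [j _] := proj1 hz b.
by exists (j ∘ i), z, i, j.
Qed.

Lemma zero_morphism_unique a b (f g : hom a b) :
  is_zero_morphism f -> is_zero_morphism g -> f = g.
Proof.
move=> [z [i [j [hz ->]]]] [z' [i' [j' [hz' ->]]]].
have [l _] := proj1 hz z'.
have [i0 i0P] := proj2 hz' a; have [j0 j0P] := proj1 hz b.
rewrite (i0P i') -(i0P (l ∘ i)) comp_assoc.
by rewrite (j0P j) -(j0P (j' ∘ l)).
Qed.

Lemma zero_morphism_compl a b c (g : hom b c) (f : hom a b) :
  is_zero_morphism f -> is_zero_morphism (g ∘ f).
Proof.
by move=> [z [i [j [hz ->]]]]; exists z, i, (g ∘ j); rewrite comp_assoc.
Qed.

Lemma zero_morphism_compr a b c (g : hom b c) (f : hom a b) :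
  is_zero_morphism g -> is_zero_morphism (g ∘ f).
Proof.
by move=> [z [i [j [hz ->]]]]; exists z, (i ∘ f), j; rewrite comp_assoc.
Qed.

Lemma is_kernel_lift k a b (i : hom k a) (f : hom a b) t (h : hom t a) :
  is_kernel i f -> is_zero_morphism (f ∘ h) -> exists r : hom t k, i ∘ r = h.
Proof. by move=> [_ univ] /univ [r [rP _]]; exists r. Qed.

Lemma is_kernel_mono k a b (i : hom k a) (f : hom a b) :
  is_kernel i f -> is_mono i.
Proof.
move=> [fi univ] t g h gh.
have [|r [_ r_uniq]] := univ t (i ∘ h).
  by rewrite comp_assoc; apply: zero_morphism_compr.
by rewrite -(r_uniq g) // -(r_uniq h).
Qed.

Lemma is_kernel_intro k a b (i : hom k a) (f : hom a b) :
  is_zero_morphism (f ∘ i) -> is_mono i ->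
  (forall t (h : hom t a), is_zero_morphism (f ∘ h) ->
    exists r : hom t k, i ∘ r = h) ->
  is_kernel i f.
Proof.
move=> fi mono ex; split=> // t h /ex [r rP]; exists r; split=> // r' r'P.
by apply: mono; rewrite rP.
Qed.

(** If [p2] kills a morphism, then [f] kills its first component, which therefore factors through
    [i]; the second components are both zero. *)
Lemma is_kernel_pullback k a b c d (i : hom k a) (f : hom a c) (g : hom b c)
    (p1 : hom d a) (p2 : hom d b) (i' : hom k d) :
  is_kernel i f -> is_pullback f g p1 p2 ->
  p1 ∘ i' = i -> is_zero_morphism (p2 ∘ i') -> is_kernel i' p2.
Proof.
move=> ker pb e1 e2; apply: is_kernel_intro => //.
- move=> t r r' rr'; apply: (is_kernel_mono ker).
  by rewrite -e1 -!comp_assoc rr'.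
- move=> t h hz; have [|r rP] := is_kernel_lift (h := p1 ∘ h) ker.
    rewrite comp_assoc (proj1 pb) -comp_assoc; exact: zero_morphism_compl.
  exists r; apply: (is_pullback_jointly_monic pb); rewrite comp_assoc.
    by rewrite e1.
  by apply: zero_morphism_unique => //; apply: zero_morphism_compr.
Qed.

Lemma kernel_pullback_exists k a b c d (i : hom k a) (f : hom a c) (g : hom b c)
    (p1 : hom d a) (p2 : hom d b) :
  is_kernel i f -> is_pullback f g p1 p2 ->
  exists i' : hom k d,
    p1 ∘ i' = i /\ is_zero_morphism (p2 ∘ i') /\ is_kernel i' p2.
Proof.
move=> ker pb; have [o oz] := zero_morphism_exists k b.
have [|i' [e1 e2]] := is_pullback_lift (r1 := i) (r2 := o) pb.
  apply: zero_morphism_unique; first exact: (proj1 ker).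
  exact: zero_morphism_compl.
have z : is_zero_morphism (p2 ∘ i') by rewrite e2.
by exists i'; do 2 split=> //; exact: (is_kernel_pullback ker pb).
Qed.

Lemma is_cokernel_regular_epi a b c (q : hom b c) (f : hom a b) :
  is_cokernel q f -> is_regular_epi q.
Proof.
move=> [qf univ]; have [o oz] := zero_morphism_exists a b.
exists a, f, o; split.
  by apply: zero_morphism_unique => //; apply: zero_morphism_compl.
by move=> t h e; apply: univ; rewrite e; apply: zero_morphism_compl.
Qed.

Lemma kernel_exists (fc : finitely_complete C) a b (f : hom a b) :
  exists k (i : hom k a), is_kernel i f.
Proof.
have [z hz] := pointed; have [j jP] := proj1 hz b.
(* The kernel is the pullback of [f] along the morphism from the zero object. *)
have [k [i [o pb]]] := pullback_exists f j fc.
have zP t (r r' : hom t z) : r = r'.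
  by have [r0 r0P] := proj2 hz t; rewrite (r0P r) (r0P r').
exists k, i; apply: is_kernel_intro.
- by exists z, o, j; rewrite (proj1 pb).
- move=> t g h gh; exact: (is_pullback_jointly_monic pb).
- move=> t h hh; have [o' _] := proj2 hz t.
  have [|r [rP _]] := is_pullback_lift (r1 := h) (r2 := o') pb; last by exists r.
  by apply: zero_morphism_unique => //; exists z, o', j.
Qed.

(** Everything is reduced to pullbacks: the product of [b] with itself is a pullback over the zero
    object, and the equalizer is the pullback of the pairing of [f] and [g] along the diagonal. *)
Lemma equalizer_exists (fc : finitely_complete C) a b (f g : hom a b) :
  exists e (m : hom e a), f ∘ m = g ∘ m /\ is_mono m /\
    forall t (h : hom t a), f ∘ h = g ∘ h -> exists r : hom t e, m ∘ r = h.
Proof.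
have [z hz] := pointed; have [o _] := proj2 hz b.
have zP t (r r' : hom t z) : r = r'.
  by have [r0 r0P] := proj2 hz t; rewrite (r0P r) (r0P r').
have [bb [p1 [p2 prod]]] := pullback_exists o o fc.
have [diag [d1 d2]] := is_pullback_lift prod (zP _ (o ∘ idm b) (o ∘ idm b)).
have [fg [fg1 fg2]] := is_pullback_lift prod (zP _ (o ∘ f) (o ∘ g)).
have [e [m [n pb]]] := pullback_exists fg diag fc.
have en : f ∘ m = n /\ g ∘ m = n.
  rewrite -{1}fg1 -fg2 -!comp_assoc (proj1 pb) !comp_assoc d1 d2.
  by rewrite comp_idl.
exists e, m; split; first by rewrite (proj1 en) (proj2 en).
split.
- move=> t r r' rr'; apply: (is_pullback_jointly_monic pb) => //.
  by rewrite -(proj1 en) -!comp_assoc rr'.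
- move=> t h fh.
  have [|r [rP _]] := is_pullback_lift (r1 := h) (r2 := f ∘ h) pb.
    apply: (is_pullback_jointly_monic prod); rewrite !comp_assoc.
      by rewrite fg1 d1 comp_idl.
    by rewrite fg2 d2 comp_idl.
  by exists r.
Qed.

End ZeroMorphisms.

(** * The Short Five Lemma and extensions in a homological category *)

Section Homological.
Variable C : category.
Hypothesis hC : is_homological C.

Let pointed : is_pointed C := proj1 hC.
Let complete : finitely_complete C := proj1 (proj1 (proj2 hC)).

Lemma regular_epi_pullback (a b c d : C) (f : hom a c) (g : hom b c)
    (p1 : hom d a) (p2 : hom d b) :
  is_pullback f g p1 p2 -> is_regular_epi f -> is_regular_epi p2.
Proof. have [_ [[_ [_ stable]] _]] := hC; exact: stable. Qed.

(* Pulling [q] and [q'] back along the regular epimorphism [q] splits both of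
   them, so that the pullback of [v] is invertible. *)
Lemma short_five_over (K E K' E' Q : C) (k : hom K E) (q : hom E Q)
    (k' : hom K' E') (q' : hom E' Q) (u : hom K K') (v : hom E E') :
  is_kernel k q -> is_regular_epi q -> is_kernel k' q' ->
  v ∘ k = k' ∘ u -> q' ∘ v = q -> is_iso u -> is_iso v.
Proof.
move=> ker q_epi ker' vk qv u_iso.
have [R [r1 [r2 pb]]] := pullback_exists q q complete.
have [R' [r1' [r2' pb']]] := pullback_exists q' q complete.
have [s [s1 s2]] := is_pullback_lift pb (eq_refl (q ∘ idm E)).
(* The section of [r2'] is the pair of [v] and the identity; with this choice [w], which is [v] on
   first components, respects the splittings. *)
have [|s' [s'1 s'2]] := is_pullback_lift (r1 := v) (r2 := idm E) pb'.
  by rewrite comp_idr.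
have [|w [w1 w2]] := is_pullback_lift (r1 := v ∘ r1) (r2 := r2) pb'.
  by rewrite comp_assoc qv (proj1 pb).
have [j [j1 [j2 jker]]] := kernel_pullback_exists pointed ker pb.
have [j' [j'1 [j'2 j'ker]]] := kernel_pullback_exists pointed ker' pb'.
have ws : w ∘ s = s' ∘ idm E.
  apply: (is_pullback_jointly_monic pb'); rewrite comp_idr comp_assoc.
    by rewrite w1 -comp_assoc s1 s'1 comp_idr.
  by rewrite w2 s2 s'2.
have w_iso : is_iso w.
{ have [_ [_ ssfl]] := hC.
  apply: (ssfl K R E K' R' E j r2 s j' r2' s' u w (idm E)) => //.
  - apply: (is_pullback_jointly_monic pb'); rewrite !comp_assoc.
      by rewrite w1 j'1 -comp_assoc j1.
    rewrite w2; apply: zero_morphism_unique => //.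
    exact: zero_morphism_compr.
  - by rewrite w2 comp_idl.
  - exact: is_iso_id. }
have [w' [w'w ww']] := w_iso.
have r1'_epi : is_regular_epi r1'.
  exact: regular_epi_pullback (is_pullback_sym pb') q_epi.
(* If [v] identifies [x] and [y], then [w] identifies the points [(x, y)] and [(y, y)] of [R], and
   [w] is invertible. *)
have v_mono : is_mono v.
  move=> t x y vxy.
  have qxy : q ∘ x = q ∘ y by rewrite -qv -!comp_assoc vxy.
  have [d [d1 d2]] := is_pullback_lift pb qxy.
  have [d' [d'1 d'2]] := is_pullback_lift pb (eq_refl (q ∘ y)).
  rewrite -d1 -d'1 -(comp_idl d) -(comp_idl d') -w'w -!comp_assoc.
  do 2 f_equal.
  apply: (is_pullback_jointly_monic pb'); rewrite !comp_assoc.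
    by rewrite w1 -!comp_assoc d1 d'1.
  by rewrite w2 d2 d'2.
(* The regular epimorphism [r1'] factors through [v], as [v ∘ r1 = r1' ∘ w]. *)
apply: (is_regular_epi_mono_iso r1'_epi v_mono (h := r1 ∘ w')).
by rewrite comp_assoc -w1 -comp_assoc ww' comp_idr.
Qed.

(** Composing [q'] with the inverse of [w] does not change its kernel and brings both rows over the
    same base [Q]. *)
Lemma short_five (K E Q K' E' Q' : C) (k : hom K E) (q : hom E Q)
    (k' : hom K' E') (q' : hom E' Q')
    (u : hom K K') (v : hom E E') (w : hom Q Q') :
  is_kernel k q -> is_regular_epi q -> is_kernel k' q' ->
  v ∘ k = k' ∘ u -> q' ∘ v = w ∘ q -> is_iso u -> is_iso w -> is_iso v.
Proof.
move=> ker q_epi ker' vk qv u_iso [w' [w'w ww']].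
apply: (@short_five_over K E K' E' Q k q k' (w' ∘ q') u v) => //; last first.
  by rewrite -comp_assoc qv comp_assoc w'w comp_idl.
apply: is_kernel_intro.
- by rewrite -comp_assoc; apply: zero_morphism_compl; case: ker'.
- exact: is_kernel_mono ker'.
- move=> t h hz; apply: (is_kernel_lift ker').
  by rewrite -(comp_idl q') -ww' -!comp_assoc (comp_assoc w');
    apply: zero_morphism_compl.
Qed.

(* The kernel pair [(p1, p2)] of [q] has [p2] split by the diagonal with kernel
   [k]; if [h] kills [k], the equalizer of [h ∘ p1] and [h ∘ p2] contains both
   the diagonal and [k], hence is everything by the Split Short Five Lemma. *)
Lemma regular_epi_is_cokernel (K E Q : C) (k : hom K E) (q : hom E Q) :
  is_kernel k q -> is_regular_epi q -> is_cokernel q k.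
Proof.
move=> ker q_epi; split; first by case: ker.
move=> t h hk.
have [R [p1 [p2 pb]]] := pullback_exists q q complete.
have [s [s1 s2]] := is_pullback_lift pb (eq_refl (q ∘ idm E)).
have [j [j1 [j2 jker]]] := kernel_pullback_exists pointed ker pb.
have [e [m [hm [m_mono m_univ]]]] :=
  equalizer_exists pointed complete (h ∘ p1) (h ∘ p2).
have [|s' ms'] := m_univ _ s; first by rewrite -!comp_assoc s1 s2.
have [|j' mj'] := m_univ _ j.
  apply: zero_morphism_unique; rewrite -comp_assoc.
    by rewrite j1.
  exact: zero_morphism_compl.
(* [m] is a morphism of split epimorphisms from [p2 ∘ m] to [p2], with identities on the kernel [K]
   and on the base [E]. *)
have m_iso : is_iso m.
{ have [_ [_ ssfl]] := hC.
  apply: (ssfl K e E K R E j' (p2 ∘ m) s' j p2 s (idm K) m (idm E)) => //.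
  - by rewrite -comp_assoc ms' s2.
  - apply: is_kernel_intro.
    + by rewrite -comp_assoc mj'.
    + move=> x y z yz.
      by apply: (is_kernel_mono jker); rewrite -mj' -!comp_assoc yz.
    + move=> x y; rewrite -comp_assoc => /(is_kernel_lift jker) [r rP].
      by exists r; apply: m_mono; rewrite comp_assoc mj'.
  - by rewrite comp_idr.
  - by rewrite comp_idl.
  - by rewrite comp_idr.
  - exact: is_iso_id.
  - exact: is_iso_id. }
have hp : h ∘ p1 = h ∘ p2.
  have [m' [_ mm']] := m_iso.
  by rewrite -(comp_idr (h ∘ p1)) -(comp_idr (h ∘ p2)) -mm' !comp_assoc hm.
(* Any pair coequalized by [q] lifts to the kernel pair, so [h] coequalizes it as well. *)
have [a [f [g [qfg q_univ]]]] := q_epi.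
apply: q_univ; have [l [l1 l2]] := is_pullback_lift pb qfg.
by rewrite -l1 -l2 !comp_assoc hp.
Qed.

(** This replaces the cokernel condition by one that is stable under pullback. *)
Lemma extension_iff (K E Q : C) (k : hom K E) (q : hom E Q) :
  is_extension k q <-> is_kernel k q /\ is_regular_epi q.
Proof.
split=> [[ker coker]|[ker epi]]; split=> //.
  exact: is_cokernel_regular_epi coker.
exact: regular_epi_is_cokernel.
Qed.

Lemma extension_pullback (K E Q X P : C) (k : hom K E) (q : hom E Q)
    (x : hom X Q) (p1 : hom P E) (p2 : hom P X) (k' : hom K P) :
  is_extension k q -> is_pullback q x p1 p2 ->
  p1 ∘ k' = k -> is_zero_morphism (p2 ∘ k') -> is_extension k' p2.
Proof.
move=> /extension_iff [ker epi] pb e1 e2; apply/extension_iff; split.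
  exact: (is_kernel_pullback ker pb).
exact: (regular_epi_pullback pb).
Qed.

Lemma extension_iso (K E Q K' E' Q' : C) (k : hom K E) (q : hom E Q)
    (k' : hom K' E') (q' : hom E' Q')
    (u : hom K' K) (v : hom E' E) (w : hom Q' Q) :
  is_extension k q -> v ∘ k' = k ∘ u -> q ∘ v = w ∘ q' ->
  is_iso u -> is_iso v -> is_iso w -> is_extension k' q'.
Proof.
move=> [[qk ker] [_ coker]] vk qv [u' [u'u uu']] [v' [v'v vv']] [w' [w'w ww']].
have kv : k' ∘ u' = v' ∘ k.
  by rewrite -(comp_idr k) -uu' !comp_assoc -(comp_assoc v') -vk comp_assoc v'v
    comp_idl.
have vq : q' ∘ v' = w' ∘ q.
  by rewrite -(comp_idr q) -vv' !comp_assoc -(comp_assoc w') qv comp_assoc w'w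
    comp_idl.
have qk' : is_zero_morphism (q' ∘ k').
  rewrite -(comp_idl q') -w'w -(comp_assoc w') -qv -!comp_assoc vk.
  by rewrite !comp_assoc -(comp_assoc w'); apply: zero_morphism_compr;
    apply: zero_morphism_compl.
split; split=> //.
- move=> t h hz.
  have [|r [rP r_uniq]] := ker t (v ∘ h).
    by rewrite comp_assoc qv -comp_assoc; apply: zero_morphism_compl.
  exists (u' ∘ r); split.
    by rewrite comp_assoc kv -comp_assoc rP comp_assoc v'v comp_idl.
  move=> r' r'P; rewrite (r_uniq (u ∘ r')) ?comp_assoc ?u'u ?comp_idl //.
  by rewrite -vk -comp_assoc r'P.
- move=> t h hz.
  have [|r [rP r_uniq]] := coker t (h ∘ v').
    by rewrite -comp_assoc -kv comp_assoc; apply: zero_morphism_compr.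
  exists (r ∘ w); split.
    by rewrite -comp_assoc -qv comp_assoc rP -comp_assoc v'v comp_idr.
  move=> r' r'P; rewrite (r_uniq (r' ∘ w')) -?comp_assoc ?w'w ?comp_idr //.
  by rewrite -vq comp_assoc r'P.
Qed.

(** The comparison [l] from [E] to the pullback lies over [Q] and is [u] on kernels, so the Short
    Five Lemma over a fixed base makes it invertible. *)
Lemma extension_morphism_pullback (K E Q K' E' Q' : C)
    (k : hom K E) (q : hom E Q) (k' : hom K' E') (q' : hom E' Q')
    (u : hom K K') (v : hom E E') (w : hom Q Q') :
  is_extension k q -> is_extension k' q' ->
  v ∘ k = k' ∘ u -> q' ∘ v = w ∘ q -> is_iso u -> is_pullback q' w v q.
Proof.
move=> /extension_iff [ker epi] [ker' _] vk qv u_iso.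
have [P [p1 [p2 pb]]] := pullback_exists q' w complete.
have [l [l1 l2]] := is_pullback_lift pb qv.
have [j [j1 [j2 jker]]] := kernel_pullback_exists pointed ker' pb.
have l_iso : is_iso l.
  apply: (short_five_over ker epi jker _ l2 u_iso).
  apply: (is_pullback_jointly_monic pb); rewrite !comp_assoc.
    by rewrite l1 j1.
  rewrite l2; apply: zero_morphism_unique; first by case: ker.
  exact: zero_morphism_compr.
by rewrite -l1 -l2; apply: is_pullback_comp_iso.
Qed.

End Homological.

(** * Local objects and morphisms inverted by the reflection *)

Section Reflection.
Variables (C : category) (PX : C -> Prop).
Variable F : functor C (full_subcategory PX).
Variable eta : nat_trans (functor_id C) (functor_comp (inclusion PX) F).
Hypothesis hF : left_adjoint_with_unit eta.

Let L : functor C C := functor_comp (inclusion PX) F.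
Let unit (a : C) : hom a (L a) := eta a.

Lemma unit_natural (a b : C) (f : hom a b) : unit b ∘ f = fmap L f ∘ unit a.
Proof. exact: (nt_natural eta f). Qed.

Lemma reflection_lift (a y : C) (f : hom a y) :
  PX y -> exists g : hom (L a) y, g ∘ unit a = f.
Proof. by move=> hy; have [g [gP _]] := @hF a (exist _ y hy) f; exists g. Qed.

Lemma reflection_unique (a y : C) (g g' : hom (L a) y) :
  PX y -> g ∘ unit a = g' ∘ unit a -> g = g'.
Proof.
move=> hy e; have [r [_ r_uniq]] := @hF a (exist _ y hy) (g' ∘ unit a).
by rewrite -(r_uniq g) // -(r_uniq g').
Qed.

Lemma L_subcategory (a : C) : PX (L a).
Proof. exact: (proj2_sig (F a)). Qed.

(** [PX] need not be closed under isomorphism, whereas this condition is; limits of objects of the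
    subcategory are local without necessarily satisfying [PX]. *)
Definition is_local (y : C) : Prop := is_iso (unit y).

(** The other composite is an endomorphism of [L y] that fixes the unit, hence the identity. *)
Lemma retract_is_local (y : C) (r : hom (L y) y) :
  r ∘ unit y = idm y -> is_local y.
Proof.
move=> ru; exists r; split=> //.
apply: reflection_unique; first exact: L_subcategory.
by rewrite -comp_assoc ru comp_idr comp_idl.
Qed.

Lemma subcategory_is_local (y : C) : PX y -> is_local y.
Proof.
by move=> hy; have [r rP] := reflection_lift (idm y) hy;
  apply: retract_is_local rP.
Qed.

Lemma local_lift (a y : C) (f : hom a y) :
  is_local y -> exists g : hom (L a) y, g ∘ unit a = f.
Proof.
move=> [r [ru _]]; exists (r ∘ fmap L f).
by rewrite -comp_assoc -unit_natural comp_assoc ru comp_idl.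
Qed.

Lemma local_unique (a y : C) (g g' : hom (L a) y) :
  is_local y -> g ∘ unit a = g' ∘ unit a -> g = g'.
Proof.
move=> [r [ru _]] e.
rewrite -(comp_idl g) -(comp_idl g') -ru -!comp_assoc; congr (_ ∘ _).
apply: reflection_unique; first exact: L_subcategory.
by rewrite -!comp_assoc e.
Qed.

(** By naturality [fmap L (unit a)] and [unit (L a)] agree on the unit, and the latter is invertible
    because [L a] is local. *)
Lemma inverted_unit (a : C) : inverted L (unit a).
Proof.
rewrite /inverted; have -> : fmap L (unit a) = unit (L a).
  apply: reflection_unique; first exact: L_subcategory.
  by rewrite -unit_natural.
by apply: subcategory_is_local; apply: L_subcategory.
Qed.

(** Both morphisms extend along [unit b] to [L b]. By naturality the extensions agree after
    composition with [fmap L f], which is invertible. *)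
Lemma inverted_unique (a b y : C) (f : hom a b) (g g' : hom b y) :
  is_local y -> inverted L f -> g ∘ f = g' ∘ f -> g = g'.
Proof.
move=> hy [f' [f'f ff']] e.
have [h hP] := local_lift g hy; have [h' h'P] := local_lift g' hy.
rewrite -hP -h'P; congr (_ ∘ _).
rewrite -(comp_idr h) -(comp_idr h') -ff' !comp_assoc; congr (_ ∘ _).
apply: local_unique => //.
by rewrite -!comp_assoc -unit_natural !comp_assoc hP h'P.
Qed.

(** The projections extend along the unit to [L d], where they induce a retraction of the unit. *)
Lemma pullback_is_local (a b c d : C) (f : hom a c) (g : hom b c)
    (p1 : hom d a) (p2 : hom d b) :
  is_pullback f g p1 p2 -> is_local a -> is_local b -> is_local c ->
  is_local d.
Proof.
move=> pb ha hb hc.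
have [r1 r1P] := local_lift p1 ha; have [r2 r2P] := local_lift p2 hb.
have [|r [r_1 r_2]] := is_pullback_lift (r1 := r1) (r2 := r2) pb.
  by apply: local_unique => //; rewrite -!comp_assoc r1P r2P (proj1 pb).
apply: (retract_is_local (r := r)).
by apply: (is_pullback_jointly_monic pb); rewrite comp_assoc ?r_1 ?r_2 comp_idr.
Qed.

Lemma kernel_is_local (k a b : C) (i : hom k a) (f : hom a b) :
  is_pointed C -> is_kernel i f -> is_local a -> is_local b -> is_local k.
Proof.
move=> pointed ker ha hb.
have [r rP] := local_lift i ha.
have [o oz] := zero_morphism_exists pointed (L k) b.
have [|s sP] := is_kernel_lift (h := r) ker.
  (* The extension [r] of [i] to [L k] is killed by [f], since [f ∘ r] and zero agree on the
     unit. *)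
  suff -> : f ∘ r = o by [].
  apply: local_unique => //; apply: zero_morphism_unique.
    by rewrite -comp_assoc rP; case: ker.
  exact: zero_morphism_compr.
apply: (retract_is_local (r := s)); apply: (is_kernel_mono ker).
by rewrite comp_assoc sP rP comp_idr.
Qed.

(* The local objects are only isomorphic to objects of the subcategory, hence
   the replacement of the vertex. *)
Lemma subcategory_pullback_exists (a b c : C) (f : hom a c) (g : hom b c) :
  finitely_complete C -> PX a -> PX b -> PX c ->
  exists (d : full_subcategory PX) (p1 : hom (inclusion PX d) a)
    (p2 : hom (inclusion PX d) b), is_pullback f g p1 p2.
Proof.
move=> complete ha hb hc; have [d [p1 [p2 pb]]] := pullback_exists f g complete.
have [r [ru ur]] : is_local d.
  by apply: pullback_is_local pb _ _ _; apply: subcategory_is_local.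
exists (F d), (p1 ∘ r), (p2 ∘ r); apply: is_pullback_comp_iso => //.
by exists (unit d).
Qed.

(** * The two implications *)

Lemma conditionally_flat_admissible :
  is_homological C -> conditionally_flat L -> admissible_regular_epi eta.
Proof.
move=> hC flat A E x x_epi P p1 p2 pb.
have pointed := proj1 hC.
have complete : finitely_complete C := proj1 (proj1 (proj2 hC)).
have hE : is_local (inclusion PX E).
  by apply: subcategory_is_local; exact: (proj2_sig E).
have hLA : is_local (L A) by apply: subcategory_is_local; apply: L_subcategory.
have [K [k ker]] := kernel_exists pointed complete (fmap (inclusion PX) x).
have hK : is_local K by apply: kernel_is_local ker hE hLA.
have ext : is_extension k (fmap (inclusion PX) x) by apply/extension_iff.
have Lext : is_extension (fmap L k) (fmap L (fmap (inclusion PX) x)).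
(* The inverses of the three units form an isomorphism from the image sequence to the extension
   itself. *)
{ have [u [uK Ku]] := hK; have [v [vE Ev]] := hE; have [w [wA Aw]] := hLA.
  apply: (extension_iso (u := u) (v := v) (w := w) ext).
  - apply: local_unique => //.
    by rewrite -!comp_assoc -unit_natural uK comp_assoc vE comp_idl comp_idr.
  - apply: local_unique => //.
    rewrite -!comp_assoc -unit_natural vE comp_idr comp_assoc.
    by rewrite wA comp_idl.
  - by exists (unit K).
  - by exists (unit (inclusion PX E)).
  - by exists (unit (L A)). }
have [k' [k'1 [k'2 _]]] :=
  kernel_pullback_exists pointed ker (is_pullback_sym pb).
have [_ /(extension_iff hC) [Lker' Lepi']] : is_flat L k' p1.
  exact: flat (conj ext Lext) (is_pullback_sym pb) k'1 k'2.
have Lp2 : is_iso (fmap L p2).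
(* [fmap L p2] is the identity on [L K] and the inverted unit on quotients. *)
{ apply: (short_five hC Lker' Lepi' (proj1 Lext) (u := idm _)
    (w := fmap L (unit A))).
  - by rewrite comp_idr -fmap_comp k'1.
  - by rewrite -!fmap_comp; congr (fmap L _); rewrite (proj1 pb).
  - exact: is_iso_id.
  - exact: inverted_unit. }
apply: is_pullback_of_isos => //.
- by rewrite -!fmap_comp; congr (fmap F _); exact: (proj1 pb).
- exact: (inverted_unit A).
Qed.

Lemma admissible_inverted (A : C) (E : full_subcategory PX)
    (x : hom (inclusion PX E) (L A)) (P : C)
    (p1 : hom P A) (p2 : hom P (inclusion PX E)) :
  admissible_regular_epi eta -> is_regular_epi x ->
  is_pullback (unit A) x p1 p2 -> inverted L p2.
Proof.
move=> adm x_epi pb.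
have := adm A E x x_epi P p1 p2 pb.
by move/is_pullback_iso; apply; exact: (inverted_unit A).
Qed.

Lemma admissible_conditionally_flat :
  is_homological C -> admits_functorial_fiberwise_localization eta ->
  admissible_regular_epi eta -> conditionally_flat L.
Proof.
move=> hC [ffl] adm K E Q X P k q x p1 p2 k' [ext Lext] pb e1 e2.
have pointed := proj1 hC.
have complete : finitely_complete C := proj1 (proj1 (proj2 hC)).
have hL a : is_local (L a) by apply: subcategory_is_local; apply: L_subcategory.
have ext' : is_extension k' p2 := extension_pullback hC ext pb e1 e2.
split=> //.
pose xE := Extension ext; pose xP := Extension ext'.
(* The projection [p1] is part of a morphism of extensions that is the identity on kernels;
   functoriality of the fiberwise localization is applied to it. *)
have mk : p1 ∘ k' = k ∘ idm K by rewrite comp_idr.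
pose m : ext_morphism xP xE := @ExtMorphism C xP xE (idm K) p1 x mk (proj1 pb).
have := ffl_comm_k ffl m; have := ffl_comm_q ffl m; have := ffl_comm_e ffl m.
move: (ffl_map ffl m); case: (ffl xE); case: (ffl xP) => /=.
move=> P' kP qP extP eP eP_inv ekP eqP E' kE qE extE eE eE_inv ekE eqE n ne nq nk.
rewrite comp_idl in eqP; rewrite comp_idl in eqE.
have pbn : is_pullback qE x n qP.
  apply: (extension_morphism_pullback hC extP extE nk) => //.
  exact: (fmap_iso L (is_iso_id K)).
(* As [eE] is inverted, [L E'] is isomorphic to [L E], and [t] is the unit of [E'] followed by this
   isomorphism. *)
have [t te] : exists t : hom E' (L E), t ∘ eE = unit E.
  have [i [ie _]] := eE_inv; exists (i ∘ unit E').
  by rewrite -comp_assoc unit_natural comp_assoc ie comp_idl.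
have tk : t ∘ kE = fmap L k ∘ idm (L K).
  rewrite comp_idr; apply: local_unique; first exact: hL.
  by rewrite -comp_assoc -ekE comp_assoc te unit_natural.
have tq : fmap L q ∘ t = unit Q ∘ qE.
  apply: inverted_unique (hL Q) eE_inv _.
  by rewrite -!comp_assoc te eqE unit_natural.
have pbt : is_pullback (fmap L q) (unit Q) t qE.
  by apply: (extension_morphism_pullback hC extE Lext tk tq); apply: is_iso_id.
(* Admissibility is stated for objects of the subcategory, so [W] is chosen there and not merely
   local. *)
have [W [w1 [w2 pbW]]] := subcategory_pullback_exists (fmap L q) (fmap L x)
  complete (L_subcategory E) (L_subcategory X) (L_subcategory Q).
(* Naturality rewrites [unit Q ∘ x] as [fmap L x ∘ unit X], so that the pasted square can be
   cancelled against the one defining [W]. *)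
have pbP := is_pullback_paste pbt pbn; rewrite unit_natural in pbP.
have [|c [c1 c2]] := is_pullback_lift (r1 := t ∘ n) (r2 := unit X ∘ qP) pbW.
  by rewrite (proj1 pbP) comp_assoc.
(* By cancellation [c] is the projection to [W] of the pullback of [w2] along the unit of [X], and
   [w2] is a regular epimorphism as a pullback of [fmap L q]. *)
have c_inv : inverted L c.
  apply: (admissible_inverted (x := w2) (p1 := qP) adm).
    apply: (regular_epi_pullback hC pbW).
    by have /(extension_iff hC) [] := Lext.
  by apply: is_pullback_sym; apply: (is_pullback_cancel pbW); rewrite ?c1.
have [j [j1 [j2 _]]] := kernel_pullback_exists pointed (proj1 Lext) pbW.
have extW : is_extension j w2 := extension_pullback hC Lext pbW j1 j2.
have hW : is_local (inclusion PX W).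
  by apply: subcategory_is_local; exact: (proj2_sig W).
have [r [ru ur]] := hW.
(* The comparison from [L P] to [W] is the extension of [c ∘ eP] along the unit; it is invertible
   because [c] and [eP] are both inverted. *)
have theta : (r ∘ fmap L (c ∘ eP)) ∘ unit P = c ∘ eP.
  by rewrite -comp_assoc -unit_natural comp_assoc ru comp_idl.
apply: (extension_iso (u := idm (L K)) (v := r ∘ fmap L (c ∘ eP))
  (w := idm (L X)) extW); try exact: is_iso_id.
- rewrite comp_idr; apply: local_unique => //.
  rewrite -comp_assoc -unit_natural comp_assoc theta.
  apply: (is_pullback_jointly_monic pbW); rewrite !comp_assoc.
    rewrite c1 j1 -(comp_assoc t) ne comp_assoc te -comp_assoc e1.
    exact: unit_natural.
  (* The components in [L X] are both zero: one through [p2 ∘ k'], the other through [w2 ∘ j]. *)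
  apply: zero_morphism_unique.
    rewrite c2 -(comp_assoc _ qP) eqP -comp_assoc.
    exact: zero_morphism_compl.
  exact: zero_morphism_compr.
- rewrite comp_idl; apply: local_unique => //.
  by rewrite -comp_assoc theta comp_assoc c2 -comp_assoc eqP unit_natural.
- apply: is_iso_comp; first by exists (unit (inclusion PX W)).
  by rewrite fmap_comp; apply: is_iso_comp.
Qed.

End Reflection.

Theorem proposition4p5 (C : category) (hC : is_homological C)
    (PX : C -> Prop)
    (F : functor C (full_subcategory PX))
    (eta : nat_trans (functor_id C) (functor_comp (inclusion PX) F))
    (hF : left_adjoint_with_unit eta)
    (hL : admits_functorial_fiberwise_localization eta) :
  conditionally_flat (functor_comp (inclusion PX) F) <->
  admissible_regular_epi eta.
Proof.
split.
- exact: conditionally_flat_admissible.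
- exact: admissible_conditionally_flat.
Qed.
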